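(* Let $H$ be a locally finite, countably infinite graph. (i) If $H$ has infinitely many components, then $\rho(H)\geq 1/2$. (ii) If $H$ has finitely many components, then: (a) if $H$ has infinite chromatic number, then $\rho(H)=0$; (b) if $H$ has finite chromatic number $\chi(H)$, then \[\min\left\{\frac{b}{2(\chi(H)-1)},\frac12\right\}\leq\rho(H)\leq\min\left\{\frac{b}{\chi(H)-1},1\right\},\] where $b$ is the number of infinite components of $H$.
   Context: A graph is locally finite if every vertex has finite degree. Let $K_{\mathbb{N}}$ be the complete graph on the natural numbers $\mathbb{N}=\{1,2,\dots\}$, and $[n]=\{1,\dots,n\}$. For $S\subseteq\mathbb{N}$ the (upper) density is $\bar d(S)=\limsup_{n\to\infty}|S\cap[n]|/n$, and for a subgraph $H'\subseteq K_{\mathbb{N}}$ we set $\bar d(H')=\bar d(V(H'))$. For a countably infinite graph $H$ (vertex set of the same cardinality as $\mathbb{N}$), the Ramsey upper density $\rho(H)$ is the supremum of the values $\lambda$ for which, for every two-coloring of $E(K_{\mathbb{N}})$, there exists a monochromatic (not necessarily induced) subgraph $H'\subseteq K_{\mathbb{N}}$, isomorphic to $H$, with $\bar d(H')\geq\lambda$. *)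

(* Defs.v *)
From mathcomp Require Import all_boot all_order all_algebra.
From mathcomp Require Import finmap.
From mathcomp Require Import all_classical all_reals all_analysis.

Set Implicit Arguments.
Unset Strict Implicit.
Unset Printing Implicit Defensive.
Import Order.TTheory GRing.Theory Num.Theory.

Local Open Scope classical_set_scope.
Local Open Scope card_scope.
Local Open Scope ring_scope.

(* Vertices form a subset of a carrier type, so that graphs on [nat] can be
   compared as subgraphs of the complete graph on the positive integers. *)
Record sgraph (T : Type) := SGraph {
  vertices : set T;
  edge : rel T;
  edge_sym : symmetric edge;
  edge_irr : irreflexive edge;
  edge_vertices : forall x y, edge x y -> vertices x }.

Definition countably_infinite (T : Type) (H : sgraph T) : Prop :=
  vertices H #= [set: nat].

Definition locally_finite (T : Type) (H : sgraph T) : Prop :=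
  forall x, vertices H x -> finite_set [set y | edge H x y].

Definition connected_in (T : Type) (H : sgraph T) (x y : T) : Prop :=
  exists p : seq T, path (edge H) x p /\ last x p = y.

(* Components are represented by their vertex sets. *)
Definition components (T : Type) (H : sgraph T) : set (set T) :=
  [set C | exists2 x, vertices H x & C = [set y | connected_in H x y]].

Definition infinite_components (T : Type) (H : sgraph T) : set (set T) :=
  [set C | components H C /\ infinite_set C].

Definition colorable (T : Type) (H : sgraph T) (k : nat) : Prop :=
  exists f : T -> nat, (forall x, vertices H x -> (f x < k)%N) /\
    (forall x y, edge H x y -> f x <> f y).

Definition chromatic_number (T : Type) (H : sgraph T) (k : nat) : Prop :=
  colorable H k /\ (forall j, colorable H j -> (k <= j)%N).

Definition infinite_chromatic_number (T : Type) (H : sgraph T) : Prop :=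
  forall k, ~ colorable H k.

Definition subgraph (T : Type) (G K : sgraph T) : Prop :=
  vertices G `<=` vertices K /\ (forall x y, edge G x y -> edge K x y).

Definition isomorphic (T U : Type) (G : sgraph T) (K : sgraph U) : Prop :=
  exists f : T -> U, set_bij (vertices G) (vertices K) f /\
    (forall x y, vertices G x -> vertices G y ->
       edge G x y = edge K (f x) (f y)).

Definition KN_edge : rel nat := fun x y => [&& (0 < x)%N, (0 < y)%N & x != y].

Fact KN_edge_sym : symmetric KN_edge.
Proof. by move=> x y; rewrite /KN_edge andbCA (eq_sym x y). Qed.

Fact KN_edge_irr : irreflexive KN_edge.
Proof. by move=> x; rewrite /KN_edge eqxx !andbF. Qed.

Fact KN_edge_vertices x y : KN_edge x y -> [set n | (0 < n)%N] x.
Proof. by case/and3P. Qed.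

Definition KN : sgraph nat := SGraph KN_edge_sym KN_edge_irr KN_edge_vertices.

(* The coloring of the edge xy is [c x y]; values of [c] off the edges of the
   complete graph play no role. *)
Definition monochromatic (c : nat -> nat -> bool) (G : sgraph nat) : Prop :=
  exists i : bool, forall x y, edge G x y -> c x y = i.

(* The term of index 0 is 0, by the convention x / 0 = 0. *)
Definition upper_density (R : realType) (S : set nat) : R :=
  limn_sup (fun n : nat =>
    #|` fset_set (S `&` [set k | (1 <= k <= n)%N])|%:R / n%:R : R).

Definition ramsey_upper_density (R : realType) (T : Type) (H : sgraph T) : R :=
  sup [set lambda : R |
    forall c : nat -> nat -> bool, symmetric c ->
      exists H' : sgraph nat,
        [/\ subgraph H' KN, monochromatic c H', isomorphic H' H
          & lambda <= upper_density R (vertices H')]].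
Arguments ramsey_upper_density R {T} H.

(* Main.v *)
Require Import Defs.
From mathcomp Require Import all_boot all_order all_algebra.
From mathcomp Require Import finmap zify lra.
From mathcomp Require Import all_classical all_reals all_analysis.

Set Implicit Arguments.
Unset Strict Implicit.
Unset Printing Implicit Defensive.
Import Order.TTheory GRing.Theory Num.Theory.
Local Open Scope classical_set_scope.
Local Open Scope card_scope.
Local Open Scope ring_scope.

(** The upper bound comes from one coloring: with [k = chi - 1], an edge [xy] has color
    [true] when [x] and [y] are congruent modulo [k]. The color [false] is then a
    [k]-colorable graph, so that it contains no copy of [H], and in a copy of color [true]
    every component stays in one residue class, so that [b] infinite components reach
    density at most [b / k] ([ramsey_density_le_finite]).

    For the lower bounds one has to cover half of the integers by sets which [H] can fill in
    a single color.

    With infinitely many components, cliques are enough. A maximal family of disjoint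
    infinite monochromatic cliques misses only finitely many integers, by Ramsey's theorem;
    the cliques of one of the colors have together upper density at least 1/2, and the
    components of [H] are distributed over them ([ramsey_density_ge_infinite]).

    With finitely many components only finitely many sets can be filled, and the point is
    that [chi - 1] sets of each color suffice ([ex_host_family]). Let [U] be a free
    ultrafilter on the set [B] of the integers that are not treated yet. Every vertex of [B]
    has a [U]-large neighborhood in exactly one color. The vertices of the majority color [i]
    form a [U]-large set [A] in which finitely many vertices always have infinitely many
    common neighbors of color [i]; so a locally finite graph can be embedded greedily in [A],
    and it can be made to cover [A] up to a set of density zero ([hosts_ultra]). The
    remaining set [B'] has common neighbors of the other color in [A]. When this has happened
    [chi - 1] times with the same [i], what remains of [B] together with these [chi - 1] sets
    contains a [chi]-partite structure of the color opposite to [i], in which [H] can cover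
    the whole remainder ([extendableS], [hosts_extendable]), and the process stops. It
    follows that there are at most [chi - 1] sets of each color, and the sets of one of the
    colors have density at least 1/2 together; the best [b] of them, or all if there are
    fewer, with an infinite component of [H] for each, give the bound
    ([ramsey_density_ge_finite]). *)

(** * Counting and density *)

Definition count_upto (S : set nat) (n : nat) : nat :=
  (\sum_(1 <= k < n.+1) `[< S k >])%N.

Lemma card_count_upto (S : set nat) (n : nat) :
  #|` fset_set (S `&` [set k | (1 <= k <= n)%N])| = count_upto S n.
Proof.
set s := [seq k <- index_iota 1 n.+1 | `[< S k >]].
have -> : fset_set (S `&` [set k | (1 <= k <= n)%N]) = [fset k in s]%fset.
  rewrite -[RHS]set_fsetK; congr fset_set; apply/seteqP; split=> k /=.
    by rewrite !inE /= mem_filter mem_index_iota ltnS => -[/asboolP -> ->].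
  by rewrite !inE /= mem_filter mem_index_iota ltnS => /andP[/asboolP].
rewrite card_fseq undup_id ?filter_uniq ?iota_uniq //.
by rewrite size_filter /count_upto -sumn_count sumnE big_map.
Qed.

Lemma count_uptoS (S : set nat) (n : nat) :
  count_upto S n.+1 = (count_upto S n + `[< S n.+1 >])%N.
Proof. by rewrite /count_upto big_nat_recr. Qed.

Lemma count_upto0 (S : set nat) : count_upto S 0 = 0%N.
Proof. by rewrite /count_upto big_geq. Qed.

Lemma leq_count_upto (S : set nat) (n : nat) : (count_upto S n <= n)%N.
Proof.
elim: n => [|n IH]; first by rewrite count_upto0.
by rewrite count_uptoS; case: `[< _ >]; lia.
Qed.

Lemma subset_count_upto (S S' : set nat) (n : nat) :
  (forall k, (0 < k)%N -> S k -> S' k) -> (count_upto S n <= count_upto S' n)%N.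
Proof.
move=> SS'; rewrite /count_upto big_nat_cond [leqRHS]big_nat_cond.
apply: leq_sum => k /andP[/andP[k0 _] _].
by case: asboolP => // /(SS' _ k0) ?; rewrite asboolT.
Qed.

Lemma count_uptoU (S S' : set nat) (n : nat) :
  (count_upto (S `|` S') n <= count_upto S n + count_upto S' n)%N.
Proof.
rewrite /count_upto -big_split; apply: leq_sum => k _ /=.
case: (asboolP (_ \/ _)) => // -[] ?; first by rewrite asboolT.
by rewrite [in X in (_ + X)%N]asboolT ?addn1.
Qed.

(** Density zero, in a form that only involves integers: for every [K], at most
    [n / K] elements up to [n], apart from an additive constant. *)
Definition sparse (Z : set nat) : Prop :=
  forall K, exists C, forall n, (K * count_upto Z n <= n + C)%N.

Lemma count_upto_finite (Z : set nat) : finite_set Z ->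
  exists C, forall n, (count_upto Z n <= C)%N.
Proof.
move=> Zfin; have [s sP] := (finite_seqP Z).1 Zfin.
exists (size s) => n; rewrite /count_upto.
have -> : (\sum_(1 <= k < n.+1) `[< Z k >])%N = size [seq k <- index_iota 1 n.+1 | k \in s].
  rewrite size_filter -sumn_count sumnE big_map; apply: eq_bigr => k _.
  by rewrite sP /= asboolb.
by apply: uniq_leq_size; rewrite ?filter_uniq ?iota_uniq // => x; rewrite mem_filter => /andP[].
Qed.

Lemma sparse_finite (Z : set nat) : finite_set Z -> sparse Z.
Proof.
move=> /count_upto_finite[C CP] K; exists (K * C)%N => n.
by rewrite (leq_trans _ (leq_addl _ _)) // leq_mul2l CP orbT.
Qed.

Lemma sparseU (Z Z' : set nat) : sparse Z -> sparse Z' -> sparse (Z `|` Z').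
Proof.
move=> Zs Zs' K; have [C CP] := Zs (2 * K)%N; have [C' CP'] := Zs' (2 * K)%N.
exists (C + C')%N => n.
have := CP n; have := CP' n; have := count_uptoU Z Z' n; nia.
Qed.

(** A sequence of elements of [B] with [g k >= (k + 1)^2] has at most [sqrt n] terms
    up to [n]. *)
Lemma ex_sparse (B : set nat) : infinite_set B ->
  exists Z, [/\ Z `<=` B, infinite_set Z & sparse Z].
Proof.
move=> Binf.
have step m : exists k, B k /\ (m <= k)%N.
  apply: contrapT => nk; apply: Binf; apply: sub_finite_set (finite_II m) => k Bk /=.
  by rewrite ltnNge; apply/negP => mk; apply: nk; exists k.
have [h hP] := choice step.
(* The maximum makes [g] strictly increasing as well. *)
pose g := fix g k := if k is k'.+1 then h (maxn (g k').+1 (k'.+2 ^ 2)) else h 1%N.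
have gE k : (maxn (g k).+1 (k.+2 ^ 2) <= g k.+1)%N by apply: (hP _).2.
have gS k : (g k < g k.+1)%N by have := gE k; rewrite geq_max => /andP[].
have gsq k : (k.+1 ^ 2 <= g k)%N.
  case: k => [|k]; first exact: (hP 1%N).2.
  by have := gE k; rewrite geq_max => /andP[].
have gB k : B (g k) by case: k => [|k]; apply: (hP _).1.
have gmono : {homo g : a b / (a < b)%N >-> (a < b)%N}.
  by apply: homo_ltn => // ? ? ?; apply: ltn_trans.
have ginj : injective g.
  by move=> a b gab; case: (ltngtP a b) => // /gmono; rewrite gab ltnn.
exists (range g); split.
- by move=> _ [k _ <-].
- by apply/infiniteP; rewrite (card_le_eqr (inj_card_eq (in2W ginj))).
move=> K; exists (K ^ 2)%N => n.
suff sqn : ((count_upto (range g) n) ^ 2 <= n)%N.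
  (* if [c] is the count, then [K * c <= c^2 + K^2 <= n + K^2] *)
  set c := count_upto _ _ in sqn *; move: sqn; rewrite !expnS !expn0 !muln1; nia.
have : (count_upto (range g) n <= 0)%N \/
    exists2 k, (count_upto (range g) n <= k.+1)%N & (g k <= n)%N.
  elim: n => [|n IH]; first by left; rewrite count_upto0.
  rewrite count_uptoS; case: asboolP => [[k _ gk]|_]; last first.
    by rewrite addn0; case: IH => [?|[k ? ?]]; [left|right; exists k => //; lia].
  right; exists k; last by rewrite gk.
  case: IH => [|[j jc gj]]; first lia.
  have : (j < k)%N.
    rewrite ltnNge leq_eqVlt; apply/negP => /orP[/eqP kj|/gmono].
      by move: gk gj; rewrite kj; lia.
    by rewrite gk; lia.
  lia.
move=> [|[k ck gk]]; first by rewrite leqn0 => /eqP ->.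
by rewrite (leq_trans _ gk) // (leq_trans _ (gsq k)) // leq_exp2r.
Qed.

Definition density_at (R : realType) (S : set nat) (n : nat) : R :=
  (count_upto S n)%:R / n%:R.

Lemma upper_densityE (R : realType) (S : set nat) :
  upper_density R S = limn_sup (density_at R S).
Proof.
by rewrite /upper_density; congr limn_sup; apply/funext => n; rewrite card_count_upto.
Qed.

Lemma density_at_ge0 (R : realType) (S : set nat) n : 0 <= density_at R S n.
Proof. by rewrite divr_ge0. Qed.

Lemma density_at_le1 (R : realType) (S : set nat) n : density_at R S n <= 1.
Proof.
case: n => [|n]; first by rewrite /density_at invr0 mulr0.
by rewrite ler_pdivrMr ?ltr0n // mul1r ler_nat leq_count_upto.
Qed.

Lemma upper_density_inf (R : realType) (S : set nat) :
  upper_density R S = inf (range (sups (density_at R S))).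
Proof.
rewrite upper_densityE; apply: limn_supE.
exists 1; split=> // M M1 n _ /=.
by rewrite ger0_norm ?density_at_ge0 // (le_trans (density_at_le1 _ _ _)) // ltW.
Qed.

Lemma has_sup_density_tail (R : realType) (S : set nat) n :
  has_sup (sdrop (density_at R S) n).
Proof.
split; first by exists (density_at R S n), n => /=.
by exists 1 => _ [k _ <-]; apply: density_at_le1.
Qed.

Lemma sups_density_ge0 (R : realType) (S : set nat) n :
  0 <= sups (density_at R S) n.
Proof.
apply: (@le_trans _ _ (density_at R S n)); first exact: density_at_ge0.
apply: (ub_le_sup (has_sup_density_tail R S n).2); by exists n => /=.
Qed.

Lemma upper_density_ge (R : realType) (S : set nat) (a : R) :
  (forall e, 0 < e -> forall N, exists n, (N <= n)%N /\ a - e <= density_at R S n) ->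
  a <= upper_density R S.
Proof.
move=> aS; apply/ler_addgt0Pr => e e0; rewrite -lerBlDr upper_density_inf.
apply: lb_le_inf; first by exists (sups (density_at R S) 0%N), 0%N.
move=> _ [N _ <-]; have [n [Nn an]] := aS _ e0 N.
apply: (le_trans an); apply: (ub_le_sup (has_sup_density_tail R S N).2).
by exists n.
Qed.

Lemma upper_density_le (R : realType) (S : set nat) (a : R) :
  (forall e, 0 < e -> exists N, forall n, (N <= n)%N -> density_at R S n <= a + e) ->
  upper_density R S <= a.
Proof.
move=> aS; apply/ler_addgt0Pr => e e0; have [N aN] := aS _ e0; rewrite upper_density_inf.
apply: (@le_trans _ _ (sups (density_at R S) N)).
  apply: ge_inf; last by exists N.
  by exists 0 => _ [n _ <-]; apply: sups_density_ge0.
by apply: sup_le_ub; [exact: (has_sup_density_tail R S N).1|move=> _ [n Nn <-]; apply: aN].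
Qed.

Lemma upper_density_le1 (R : realType) (S : set nat) : upper_density R S <= 1.
Proof.
apply: upper_density_le => e e0; exists 0%N => n _.
by rewrite (le_trans (density_at_le1 _ _ _)) // lerDl ltW.
Qed.

Lemma upper_density_ge0 (R : realType) (S : set nat) : 0 <= upper_density R S.
Proof.
apply: upper_density_ge => e e0 N; exists N; split=> //.
by rewrite (le_trans _ (density_at_ge0 _ _ _)) // sub0r oppr_le0 ltW.
Qed.

(** Sparse sets disappear in the limit, so that lower bounds on densities reduce to
    inequalities between integers, needed for arbitrarily large [n] only. *)
Lemma upper_density_ge_count (R : realType) (S Z : set nat) (p q : nat) :
  (0 < q)%N -> sparse Z ->
  (forall N, exists n, (N <= n)%N /\
     (p * n <= q * (count_upto S n + count_upto Z n))%N) ->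
  p%:R / q%:R <= upper_density R S.
Proof.
move=> q0 Zs pq; apply: upper_density_ge => e e0 N.
pose K := (Num.truncn (2 / e)).+1.
have Ke : 2 / e < K%:R by rewrite truncnS_gt.
have [C CP] := Zs K.
have [n [Nn pn]] := pq (N + C + 1)%N; exists n; split; first by lia.
have n0 : (0 < n%:R :> R) by rewrite ltr0n; lia.
have q0' : (0 < q%:R :> R) by rewrite ltr0n.
rewrite lerBlDr /density_at -[e in leRHS](@mulfK _ n%:R) ?gt_eqF // -mulrDl.
rewrite ler_pdivrMr // mulrAC ler_pdivlMr //.
suff zn : (count_upto Z n)%:R <= e * n%:R :> R.
  move: pn; rewrite -(ler_nat R) !natrM natrD => /le_trans; apply.
  by rewrite mulrC ler_pM2r // lerD2l.
have Kn : K%:R * (count_upto Z n)%:R <= 2 * n%:R :> R.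
  by rewrite -!natrM ler_nat; have := CP n; lia.
have c0 : (0 <= (count_upto Z n)%:R :> R) by [].
move: Ke; rewrite ltr_pdivrMr // => Ke.
have K0 : 0 < K%:R :> R by rewrite ltr0n.
rewrite -(ler_pM2l K0) (le_trans Kn) // mulrA ler_pM2r //; exact: ltW.
Qed.

Lemma upper_density_le_count (R : realType) (S : set nat) (p q C : nat) :
  (0 < q)%N -> (forall n, (q * count_upto S n <= p * n + C)%N) ->
  upper_density R S <= p%:R / q%:R.
Proof.
move=> q0 pq; apply: upper_density_le => e e0.
exists (Num.truncn (C%:R / e)).+1 => n Nn.
have n0 : (0 < n%:R :> R) by rewrite ltr0n; lia.
have q0' : (1 <= q%:R :> R) by rewrite ler1n.
have Ce : C%:R <= e * n%:R :> R.
  rewrite -ler_pdivrMl // mulrC; apply: ltW; apply: lt_le_trans (truncnS_gt _) _.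
  by rewrite ler_nat.
have qgt0 : (0 < q%:R :> R) by lra.
rewrite -[e in leRHS](@mulfK _ q%:R) ?gt_eqF // -mulrDl.
rewrite /density_at ler_pdivrMr // mulrAC ler_pdivlMr // mulrC.
move: (pq n); rewrite -(ler_nat R) natrD !natrM => /le_trans; apply.
rewrite mulrDl lerD2l (le_trans Ce) // mulrAC ler_peMr //.
by rewrite mulr_ge0 // ltW.
Qed.

(** * Pigeonhole and averaging *)

(** An upper density is already large when the counts are large for arbitrarily large
    [n]; among finitely many candidates, the one that is best infinitely often can
    therefore be fixed once and for all. *)
Lemma frequently_pigeonhole (X : finType) (P : X -> nat -> Prop) :
  (forall N, exists n, (N <= n)%N /\ exists x, P x n) ->
  exists x, forall N, exists n, (N <= n)%N /\ P x n.
Proof.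
move=> HP; apply: contrapT => nx.
have [|M MP] := @choice _ _ (fun x N => forall n, (N <= n)%N -> ~ P x n).
  move=> x; apply: contrapT => nN; apply: nx; exists x => N.
  by apply: contrapT => nn; apply: nN; exists N => n Nn Pn; apply: nn; exists n.
have [n [Mn [x Pn]]] := HP (\max_x M x)%N.
by apply: (MP x n) => //; apply: leq_trans Mn; apply: leq_bigmax.
Qed.

(** Removing a smallest entry does not decrease the average of the entries that are
    left. *)
Lemma top_average (m r : nat) (a : 'I_m -> nat) : (r <= m)%N ->
  exists S : {set 'I_m}, #|S| = r /\
    (r * (\sum_j a j) <= m * (\sum_(j in S) a j))%N.
Proof.
move=> rm; rewrite -(subKn rm); elim: (m - r)%N (leq_subr r m) => [_|d IH dm].
  exists finset.setT; rewrite cardsT card_ord subn0; split=> //.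
  rewrite leq_mul2l; apply/orP; right.
  by rewrite [leqRHS](eq_bigl predT) // => j; rewrite inE.
have [S [Sc Sa]] := IH (ltnW dm).
have [j0 j0S] : exists j, j \in S by apply/set0Pn; rewrite -card_gt0 Sc subn_gt0.
have [j jS jmin] : exists2 j, j \in S & forall k, k \in S -> (a j <= a k)%N.
  by case: (arg_minnP a j0S) => j jS jmin; exists j.
exists (S :\ j)%SET; split; first by have := cardsD1 j S; rewrite jS Sc; lia.
have SD : (\sum_(k in S) a k = a j + \sum_(k in S :\ j) a k)%N by rewrite (big_setD1 j).
have : (#|S| * a j <= \sum_(k in S) a k)%N.
  by rewrite -sum_nat_const; apply: leq_sum => k kS; apply: jmin.
rewrite Sc => jS'; move: Sa; rewrite {}SD in jS' *.
move: jS'; set s := (\sum_(k in _) _)%N; set t := (\sum_j _)%N => jS'.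
have [q qE] : exists q, (m - d = q.+1)%N by exists (m - d.+1)%N; lia.
have -> : (m - d.+1 = q)%N by lia.
rewrite qE in jS' * => Sa.
have : (q.+1 * (q * t) <= q.+1 * (m * s))%N by nia.
by rewrite leq_pmul2l.
Qed.

Lemma sum_count_upto (m : nat) (S : {set 'I_m}) (W : nat -> set nat) (V : set nat) n :
  (forall j j' k, W j k -> W j' k -> j = j') ->
  (forall (j : 'I_m) k, j \in S -> (0 < k)%N -> W j k -> V k) ->
  (\sum_(j in S) count_upto (W j) n <= count_upto V n)%N.
Proof.
move=> Wd WV; rewrite /count_upto exchange_big /= big_nat_cond [leqRHS]big_nat_cond.
apply: leq_sum => k /andP[/andP[k0 _] _].
have [[j jS Wj]|nj] := pselect (exists2 j : 'I_m, j \in S & W j k).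
  rewrite (bigD1 j) //= big1 ?addn0; last first.
    move=> j' /andP[_ /eqP jj']; rewrite asboolF // => Wj'; apply: jj'.
    by apply: val_inj; apply: Wd Wj' Wj.
  by rewrite (asboolT Wj) asboolT //; apply: WV jS k0 Wj.
by rewrite big1 // => j jS; rewrite asboolF // => Wj; apply: nj; exists j.
Qed.

Lemma count_upto_bigcup m (W : nat -> set nat) n :
  (count_upto [set k | exists j, (j < m)%N /\ W j k] n <= \sum_(j < m) count_upto (W j) n)%N.
Proof.
rewrite /count_upto exchange_big /=; apply: leq_sum => k _.
case: asboolP => //= -[j [jm Wj]].
by rewrite (bigD1 (Ordinal jm)) //= (asboolT Wj).
Qed.

Lemma count_upto_cover (S : bool -> set nat) (Z : set nat) n :
  (forall k, (0 < k)%N -> Z k \/ exists i, S i k) ->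
  (n <= count_upto Z n + (count_upto (S true) n + count_upto (S false) n))%N.
Proof.
move=> cov; apply: leq_trans (_ : count_upto (Z `|` (S true `|` S false)) n <= _)%N.
  apply: leq_trans (_ : count_upto setT n <= _)%N; last first.
    by apply: subset_count_upto => k /cov[?|[[] ?]] _; [left|right; left|right; right].
  by elim: n => // n IH; rewrite count_uptoS asboolT // addn1.
apply: leq_trans (count_uptoU _ _ _) _; rewrite leq_add2l; exact: count_uptoU.
Qed.

(** Which of the two colors is ahead may depend on [n], hence the pigeonhole. *)
Lemma majority_density (S : bool -> set nat) (Z : set nat) :
  (forall k, (0 < k)%N -> Z k \/ exists i, S i k) ->
  exists i, forall N, exists n, (N <= n)%N /\
    (n <= 2 * count_upto (S i) n + count_upto Z n)%N.
Proof.
move=> cov; apply: frequently_pigeonhole => N; exists N; split=> //.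
have := count_upto_cover N cov.
by have [?|?] := leqP (count_upto (S false) N) (count_upto (S true) N);
  [exists true|exists false]; lia.
Qed.

Lemma sparse_lt (Z : set nat) : sparse Z ->
  exists N, forall n, (N <= n)%N -> (count_upto Z n < n)%N.
Proof. by move=> /(_ 2)[C CP]; exists C.+1 => n Cn; have := CP n; lia. Qed.

(** * Components *)

Lemma connected_in_refl (T : Type) (H : sgraph T) x : connected_in H x x.
Proof. by exists [::]. Qed.

Lemma connected_in_trans (T : Type) (H : sgraph T) x y z :
  connected_in H x y -> connected_in H y z -> connected_in H x z.
Proof.
move=> [p [xp <-]] [q [yq <-]]; exists (p ++ q).
by rewrite cat_path xp yq last_cat.
Qed.

Lemma connected_in_edge (T : Type) (H : sgraph T) x y : edge H x y -> connected_in H x y.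
Proof. by move=> xy; exists [:: y]; rewrite /= xy. Qed.

Lemma connected_in_sym (T : Type) (H : sgraph T) x y : connected_in H x y -> connected_in H y x.
Proof.
move=> [p [xp <-]]; elim: p x xp => [|z p IH] x /=; first by move=> _; apply: connected_in_refl.
move=> /andP[xz zp]; apply: connected_in_trans (IH _ zp) _.
by apply: connected_in_edge; rewrite edge_sym.
Qed.

Lemma edge_verticesr (T : Type) (H : sgraph T) x y : edge H x y -> vertices H y.
Proof. by rewrite edge_sym => /(@edge_vertices _ H). Qed.

Lemma connected_in_vertices (T : Type) (H : sgraph T) x y :
  vertices H x -> connected_in H x y -> vertices H y.
Proof.
move=> Hx [p [xp <-]]; elim: p x Hx xp => //= z p IH x Hx /andP[xz zp].
exact: IH (edge_verticesr xz) zp.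
Qed.

Definition component (T : Type) (H : sgraph T) (x : T) : set T := [set y | connected_in H x y].

Lemma componentP (T : Type) (H : sgraph T) x : vertices H x -> components H (component H x).
Proof. by move=> Hx; exists x. Qed.

Lemma eq_component (T : Type) (H : sgraph T) x y :
  connected_in H x y -> component H x = component H y.
Proof.
move=> xy; apply/seteqP; split=> z; apply: connected_in_trans => //.
exact: connected_in_sym.
Qed.

Lemma component_mem (T : Type) (H : sgraph T) C x :
  components H C -> C x -> vertices H x /\ component H x = C.
Proof.
move=> [y Hy ->] yx; split; first exact: connected_in_vertices yx.
exact/esym/eq_component.
Qed.

Lemma countably_infinite_countable (T : Type) (H : sgraph T) :
  countably_infinite H -> countable (vertices H).
Proof.
by move=> Hinf; apply: (sub_countable (B := setT)) => //; rewrite (card_le_eql Hinf).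
Qed.

(** This makes [b] positive in the second part of the theorem. *)
Lemma finite_component_graph (T : Type) (H : sgraph T) :
  countably_infinite H -> finite_set (components H) ->
  exists2 C, components H C & infinite_set C.
Proof.
move=> Hinf Cfin; apply: contrapT => nC; apply: infinite_nat.
rewrite -(eq_finite_set Hinf).
apply: (@sub_finite_set _ _ (\bigcup_(C in components H) C)).
  by move=> x Hx; exists (component H x); [exact: componentP|exact: connected_in_refl].
apply: bigcup_finite => // C CH; apply: contrapT => Ci; apply: nC; by exists C.
Qed.

(** An infinite component contains an edge. This makes the denominators [chi - 1] of the
    theorem positive. *)
Lemma colorable_gt1 (T : Type) (H : sgraph T) C k : components H C -> infinite_set C ->
  colorable H k -> (1 < k)%N.
Proof.
move=> [x Hx ->] Cinf [h [hk hc]].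
have [y [z zy]] : exists y z, edge H y z.
  apply: contrapT => ne; apply: Cinf; apply: sub_finite_set (finite_set1 x) => y [p [xp <-]].
  by case: p xp => //= z p /andP[xz _]; case: ne; exists x, z.
rewrite ltnNge; apply/negP => k1; apply: (hc y z zy).
have := hk y (edge_vertices zy); have := hk z (edge_verticesr zy); lia.
Qed.

(** * Ramsey upper density *)

Lemma ramsey_density_ge (R : realType) (T : Type) (H : sgraph T) (l : R) :
  (forall c : nat -> nat -> bool, symmetric c -> exists H' : sgraph nat,
     [/\ subgraph H' KN, monochromatic c H', isomorphic H' H &
       l <= upper_density R (vertices H')]) ->
  l <= ramsey_upper_density R H.
Proof.
move=> Hl; apply: ub_le_sup => //.
exists 1 => m /(_ (fun _ _ => true))[//|H' [_ _ _ mH']].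
exact: le_trans mH' (upper_density_le1 _ _).
Qed.

(** The supremum of the empty set is 0, which is why [u] has to be nonnegative when the
    color classes of [c] contain no copy of [H] at all. *)
Lemma ramsey_density_le (R : realType) (T : Type) (H : sgraph T) (u : R)
    (c : nat -> nat -> bool) :
  0 <= u -> symmetric c ->
  (forall H' : sgraph nat, subgraph H' KN -> monochromatic c H' -> isomorphic H' H ->
     upper_density R (vertices H') <= u) ->
  ramsey_upper_density R H <= u.
Proof.
move=> u0 csym Hu; rewrite /ramsey_upper_density; set L := [set _ | _].
have Lu : ubound L u.
  by move=> l /(_ c csym)[H' [H1 H2 H3 lH']]; apply: le_trans lH' (Hu _ _ _ _).
have [L0|nL0] := pselect (L !=set0); first exact: sup_le_ub.
by rewrite sup_out // => -[].
Qed.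

Lemma ramsey_density_le1 (R : realType) (T : Type) (H : sgraph T) :
  ramsey_upper_density R H <= 1.
Proof.
by apply: (@ramsey_density_le _ _ _ _ (fun _ _ => true)) => // H' _ _ _; exact: upper_density_le1.
Qed.

(** If some value is admissible, then copies of [H] exist for all colorings and 0 is
    admissible; otherwise the supremum of the empty set is 0. *)
Lemma ramsey_density_ge0 (R : realType) (T : Type) (H : sgraph T) :
  0 <= ramsey_upper_density R H.
Proof.
rewrite /ramsey_upper_density; set L := [set _ | _].
have [[l Ll]|nL] := pselect (L !=set0); last by rewrite sup_out // => -[].
apply: ramsey_density_ge => c /Ll[H' [H1 H2 H3 _]].
by exists H'; split=> //; exact: upper_density_ge0.
Qed.

(** * Greedy embedding along an ultrafilter *)

(** Any ultrafilter above the filter of the sets that contain almost all of [Z]. *)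
Lemma ex_free_ultrafilter (Z : set nat) : infinite_set Z ->
  exists U : set_system nat,
    [/\ UltraFilter U, U Z & forall A, finite_set A -> U (~` A)].
Proof.
move=> Zinf; pose F : set_system nat := [set A | finite_set (Z `\` A)].
have FF : ProperFilter F.
  split; first by rewrite /F /= setD0.
  split=> [|A B AF BF|A B AB AF]; rewrite /F /=.
  - by rewrite setDT; apply: finite_set0.
  - by rewrite setDIr finite_setU.
  - by apply: sub_finite_set AF => x [Zx nBx]; split=> // /AB.
have [U [UU FU]] := ultraFilterLemma FF.
exists U; split=> // [|A Afin]; apply: FU; rewrite /F /=.
  by rewrite setDv; apply: finite_set0.
by rewrite setDE setCK; apply: finite_setIr.
Qed.

(** Course-of-values recursion: the choice of [g n] may depend on all earlier values. *)
Lemma history_choice (T : Type) (P : seq T -> T -> Prop) :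
  (forall s, exists a, P s a) -> exists g : nat -> T, forall n, P (mkseq g n) (g n).
Proof.
move=> /choice[h hP].
pose hist := fix hist n := if n is n'.+1 then rcons (hist n') (h (hist n')) else [::].
exists (fun n => h (hist n)) => n.
suff -> : mkseq (fun n => h (hist n)) n = hist n by apply: hP.
by elim: n => // n IH; rewrite mkseqS IH.
Qed.

Lemma filter_all_seq (T : Type) (F : set_system T) (I : eqType) (s : seq I)
    (A : I -> set T) : Filter F -> (forall v, v \in s -> F (A v)) ->
  F [set a | forall v, v \in s -> A v a].
Proof.
move=> FF; elim: s => [|v s IH] As; first by apply: filterE => ? ?; rewrite in_nil.
have Fv : F (A v) by apply: As; rewrite mem_head.
have Fs : F [set a | forall v, v \in s -> A v a].
  by apply: IH => w ws; apply: As; rewrite inE ws orbT.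
apply: filterS (filterI Fv Fs) => a [/= av as_] w; rewrite inE => /orP[/eqP->//|]; exact: as_.
Qed.

Definition nbhd_col (c : nat -> nat -> bool) (i : bool) (v : nat) : set nat :=
  [set w | c v w = i].

(** The vertices of [E] are placed one after another. The next one has finitely many
    neighbors that are already placed, and their neighborhoods of color [i] belong to [U];
    so does the intersection of these neighborhoods with [Z], and a free place remains after
    the finitely many places already taken are removed. The points of [Z] themselves must
    have large neighborhoods only if [E] has inner edges. *)
Lemma extend_embedding (T : Type) (e : rel T) (D E : set T) (f0 : T -> nat)
    (c : nat -> nat -> bool) (i : bool) (U : set_system nat) (Z : set nat) :
  symmetric e -> irreflexive e -> symmetric c ->
  UltraFilter U -> (forall A, finite_set A -> U (~` A)) -> U Z ->
  countable E -> (forall x, D x -> ~ E x) ->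
  (forall x, E x -> finite_set [set y | e x y /\ D y]) ->
  (forall x, D x -> U (nbhd_col c i (f0 x))) ->
  (forall x y, E x -> E y -> e x y -> forall v, Z v -> U (nbhd_col c i v)) ->
  exists f : T -> nat,
    [/\ forall x, ~ E x -> f x = f0 x,
        forall x y, E x -> E y -> f x = f y -> x = y,
        forall x, E x -> Z (f x) &
        forall x y, E x -> D y \/ E y -> e x y -> c (f x) (f y) = i].
Proof.
move=> esym eirr csym UU Ufree UZ /countable_injP[u uinj] DE Efin UD UE.
have {}uinj x y : E x -> E y -> u x = u y -> x = y.
  by move=> Ex Ey; apply: uinj; rewrite inE.
(* [s] lists the images of the vertices with codes below [size s]; codes that no vertex of
   [E] has also receive a value, so that [nth] and [u] match. *)
pose P (s : seq nat) (a : nat) := (forall v, v \in s -> Z v) ->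
  [/\ Z a, a \notin s &
   forall x, E x -> u x = size s ->
     (forall y, D y -> e x y -> c (f0 y) a = i) /\
     (forall y, E y -> (u y < size s)%N -> e x y -> c (nth 0%N s (u y)) a = i)].
have [s|g gP] := @history_choice _ P.
  rewrite /P; have [sZ|sZ] := pselect (forall v, v \in s -> Z v); last by exists 0%N.
  have Us : U [set a | a \notin s].
    rewrite [X in U X](_ : _ = ~` [set` s]); last by apply/seteqP; split=> a /= /negP.
    by apply: Ufree; apply: finite_seq.
  have [[x [Ex ux]]|nx] := pselect (exists x, E x /\ u x = size s); last first.
    have [a [Za sa]] := filter_ex (filterI UZ Us).
    by exists a => _; split=> // x Ex ux; case: nx; exists x.
  have /finite_seqP[d dE] := finite_image f0 (Efin x Ex).
  have Ud : U [set a | forall v, v \in d -> nbhd_col c i v a].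
    apply: filter_all_seq => v vd; have : [set` d] v by [].
    by rewrite -dE => -[y [_ Dy] <-]; apply: UD.
  have Un : U [set a | forall v, v \in s -> (exists2 y, E y & e x y) -> nbhd_col c i v a].
    have [[y Ey xy]|ny] := pselect (exists2 y, E y & e x y); last by apply: filterE => a v vs /ny.
    apply: filterS (_ : U [set a | forall v, v \in s -> nbhd_col c i v a]).
      by move=> a as_ v vs _; exact: as_.
    by apply: filter_all_seq => v vs; apply: UE xy _ (sZ _ vs).
  have [a [Za [/= sa [da na]]]] := filter_ex (filterI UZ (filterI Us (filterI Ud Un))).
  exists a => _; split=> // x' Ex' ux'.
  have {x' Ex' ux'}-> : x' = x by apply: uinj => //; rewrite ux ux'.
  split=> [y Dy xy|y Ey uy xy].
    have : [set` d] (f0 y) by rewrite -dE; exists y.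
    exact: da.
  by apply: na; [rewrite mem_nth|exists y].
have gZ n : forall k, (k < n)%N -> Z (g k).
  elim: n => // n IH k; rewrite ltnS leq_eqVlt => /orP[/eqP ->|]; last exact: IH.
  by have [|] := gP n => // v /mapP[j]; rewrite mem_iota => /andP[_ jn] ->; apply: IH.
have {}gP n : [/\ Z (g n), forall k, (k < n)%N -> g k <> g n &
   forall x, E x -> u x = n ->
     (forall y, D y -> e x y -> c (f0 y) (g n) = i) /\
     (forall y, E y -> (u y < n)%N -> e x y -> c (g (u y)) (g n) = i)].
  have [|Zg gn gx] := gP n.
    by move=> v /mapP[j]; rewrite mem_iota => /andP[_ jn] ->; apply: gZ jn.
  split=> // [k kn gk|x Ex ux].
    by move/negP: gn; rewrite -gk; apply; rewrite map_f // mem_iota.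
  have [|dx nx] := gx x Ex; first by rewrite size_mkseq.
  split=> // y Ey uy xy; have := nx y Ey; rewrite size_mkseq => /(_ uy xy).
  by rewrite nth_mkseq.
pose f x := if `[< E x >] then g (u x) else f0 x.
have fE x : E x -> f x = g (u x) by move=> Ex; rewrite /f asboolT.
have fN x : ~ E x -> f x = f0 x by move=> Ex; rewrite /f asboolF.
exists f; split=> // [x y Ex Ey|x Ex|x y Ex DEy xy].
- rewrite !fE // => gxy; apply: uinj => //.
  have [_ lx _] := gP (u x); have [_ ly _] := gP (u y).
  by case: (ltngtP (u x) (u y)) => // [/ly|/lx]; rewrite gxy.
- by rewrite fE //; have [] := gP (u x).
have [_ _ /(_ x Ex erefl)[dx nx]] := gP (u x); rewrite (fE x Ex).
have [Ey|nEy] := pselect (E y); last first.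
  by rewrite fN //; case: DEy => // Dy; rewrite csym; apply: dx.
rewrite fE //; case: (ltngtP (u x) (u y)) => [xly|ylx|uxy].
- have [_ _ /(_ y Ey erefl)[_ ny]] := gP (u y).
  by apply: ny => //; rewrite esym.
- by rewrite csym; apply: nx.
by move: xy; rewrite (uinj _ _ Ex Ey uxy) eirr.
Qed.

Lemma ultra_nbhd_col (c : nat -> nat -> bool) (U : set_system nat) i v :
  UltraFilter U -> ~ U (nbhd_col c i v) -> U (nbhd_col c (~~ i) v).
Proof.
move=> UU nU; have [//|UC] := in_ultra_setVsetC (nbhd_col c i v) UU.
by apply: filterS UC => w /= /eqP; rewrite /nbhd_col /=; case: (c v w) (i) => -[].
Qed.

Lemma majority_color (c : nat -> nat -> bool) (U : set_system nat) (B : set nat) :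
  UltraFilter U -> U B -> exists i, U [set v | B v /\ U (nbhd_col c i v)].
Proof.
move=> UU UB.
have [UP|UP] := in_ultra_setVsetC [set v | B v /\ U (nbhd_col c true v)] UU.
  by exists true.
exists false; apply: filterS (filterI UB UP) => v [Bv nP]; split=> //.
by apply: (@ultra_nbhd_col c U true) => // Uv; apply: nP.
Qed.

(** Ramsey's theorem, as the greedy embedding of the complete graph: in the majority color
    of a free ultrafilter on [B], every vertex of the majority class has a large
    neighborhood. *)
Lemma infinite_clique (c : nat -> nat -> bool) (B : set nat) :
  symmetric c -> infinite_set B ->
  exists C i, [/\ C `<=` B, infinite_set C &
    forall x y, C x -> C y -> x != y -> c x y = i].
Proof.
move=> csym Binf; have [U [UU UB Ufree]] := ex_free_ultrafilter Binf.
have [i UA] := majority_color c UU UB.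
have esym' : symmetric (fun x y : nat => x != y) by move=> x y; rewrite eq_sym.
have eirr : irreflexive (fun x y : nat => x != y) by move=> x; rewrite eqxx.
have [||x _|//|x y _ _ _ v []//|f [_ finj fA fc]] :=
  @extend_embedding nat _ set0 setT id c i U _ esym' eirr csym UU Ufree UA.
- exact: countableP.
- by [].
- by apply: sub_finite_set (finite_set0 _) => y [].
exists (range f), i; split.
- by move=> _ [x _ <-]; have [] := fA x I.
- apply/infiniteP; rewrite (card_le_eqr (inj_card_eq _)) //.
  by move=> x y _ _; apply: finj.
move=> _ _ [x _ <-] [y _ <-] fxy; apply: fc => //; first by right.
by apply: contraNneq fxy => ->.
Qed.

(** * Covering a set by a monochromatic embedding *)

Definition mono_embedding (T : Type) (H : sgraph T) (c : nat -> nat -> bool) (i : bool)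
    (V : set T) (f : T -> nat) : Prop :=
  (forall x y, V x -> V y -> f x = f y -> x = y) /\
  (forall x y, V x -> V y -> edge H x y -> c (f x) (f y) = i).

(** The set [W] to be covered and the set [A] that may be occupied differ because an
    embedding needs some room besides the vertices that it is meant to cover. *)
Definition hosts (T : Type) (H : sgraph T) (c : nat -> nat -> bool) (i : bool)
    (W A : set nat) : Prop :=
  forall V : set T, V `<=` vertices H -> infinite_set V ->
    exists f : T -> nat, [/\ mono_embedding H c i V f,
      forall x, V x -> A (f x) & forall n, W n -> exists2 x, V x & f x = n].

(** In color [i], the set [B] behaves like one part of a [(p + 1)]-partite structure
    whose other [p] parts lie in [M]: vertices placed in [B] never obstruct the embedding
    of the remaining ones in [M], if [p] colors suffice for those. *)
Definition extendable (T : Type) (H : sgraph T) (c : nat -> nat -> bool) (i : bool)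
    (p : nat) (B M : set nat) : Prop :=
  forall (V D : set T) (h f0 : T -> nat),
    V `<=` vertices H -> D `<=` V -> mono_embedding H c i D f0 ->
    (forall x, D x -> B (f0 x)) ->
    (forall x, V x -> ~ D x -> (h x < p)%N) ->
    (forall x y, V x -> ~ D x -> V y -> ~ D y -> edge H x y -> h x <> h y) ->
  exists f : T -> nat, [/\ mono_embedding H c i V f,
    forall x, D x -> f x = f0 x & forall x, V x -> ~ D x -> M (f x)].

Lemma extendable0 (T : Type) (H : sgraph T) c i B : extendable H c i 0 B set0.
Proof.
move=> V D h f0 VH DV [f0inj f0c] f0B hp hc.
have VD x : V x -> D x by move=> Vx; apply: contrapT => /(hp _ Vx).
exists f0; split=> // [|x Vx /(_ (VD _ Vx))//].
by split=> x y Vx Vy; [apply: f0inj|apply: f0c]; exact: VD.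
Qed.

Lemma sub_extendable (T : Type) (H : sgraph T) c i p B B' M : B' `<=` B ->
  extendable H c i p B M -> extendable H c i p B' M.
Proof.
move=> B'B Bext V D h f0 VH DV f0emb f0B; apply: Bext => //.
by move=> x /f0B /B'B.
Qed.

(** The class of color [p] is placed in [A], where finite subsets of [B'] have common
    neighbors. Since [A] and [B'] are contained in [B], the result is a larger partial
    embedding in [B], and [p] colors remain. The classes cannot be placed simultaneously:
    a vertex that is already in [M] may have few neighbors of color [i] in [A]. *)
Lemma extendableS (T : Type) (H : sgraph T) c i p (A B B' M : set nat)
    (U : set_system nat) :
  locally_finite H -> countable (vertices H) -> symmetric c ->
  UltraFilter U -> (forall F, finite_set F -> U (~` F)) -> U A ->
  A `<=` B -> B' `<=` B -> (forall n, A n -> ~ B' n) ->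
  (forall v, B' v -> U (nbhd_col c i v)) ->
  extendable H c i p B M -> extendable H c i p.+1 B' (A `|` M).
Proof.
move=> Hlf Hct csym UU Ufree UA AB B'B AB' B'U Bext V D h f0 VH DV [f0inj f0c] f0B hp hc.
pose E := [set x | [/\ V x, ~ D x & h x = p]].
have [||x Ex|x Dx|x y [Vx nDx hx] [Vy nDy hy] xy v Av|f [fN finj fA fc]] :=
  @extend_embedding T (edge H) D E f0 c i U A (@edge_sym _ H) (@edge_irr _ H) csym UU Ufree UA.
- by apply: sub_countable Hct; apply: subset_card_le => x [/VH].
- by move=> x Dx [].
- by case: Ex => /VH /Hlf Fx _ _; apply: sub_finite_set Fx => y [].
- by apply: B'U; apply: f0B.
- by have := hc x y Vx nDx Vy nDy xy; rewrite hx hy.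
have DE x : D x -> ~ E x by move=> Dx [].
have fD x : D x -> f x = f0 x by move=> /DE; apply: fN.
pose D1 := [set x | D x \/ E x].
have D1V : D1 `<=` V by move=> x [/DV//|[]].
have f1 : mono_embedding H c i D1 f.
  split=> x y.
    move=> [Dx|Ex] [Dy|Ey].
    - by rewrite !fD //; apply: f0inj.
    - by rewrite (fD x) // => fxy; case: (AB' (f y)); [apply: fA|rewrite -fxy; apply: f0B].
    - by rewrite (fD y) // => fxy; case: (AB' (f x)); [apply: fA|rewrite fxy; apply: f0B].
    - exact: finj.
  move=> [Dx|Ex] Dy xy.
    case: Dy => [Dy|Ey]; first by rewrite !fD //; apply: f0c.
    by rewrite csym; apply: fc => //; [left|rewrite edge_sym].
  exact: fc.
have [|x Vx nDx|x y Vx nDx Vy nDy xy|g [gemb gD gM]] := Bext V D1 h f VH D1V f1.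
- by move=> x [Dx|Ex]; [rewrite fD //; apply/B'B/f0B|apply/AB/fA].
- have nDx' : ~ D x by move=> Dx; apply: nDx; left.
  have := hp x Vx nDx'; rewrite ltnS leq_eqVlt => /orP[/eqP hx|//].
  by case: nDx; right.
- apply: hc => // ?; [apply: nDx|apply: nDy]; by left.
exists g; split=> // [x Dx|x Vx nDx]; first by rewrite gD ?fD //; left.
have [Ex|nEx] := pselect (E x); first by left; rewrite gD; [apply: fA|right].
by right; apply: gM => // -[].
Qed.

(** Color classes serve as infinite independent sets below. *)
Lemma infinite_color_class (T : Type) (V : set T) (h : T -> nat) (k : nat) :
  infinite_set V -> (forall x, V x -> (h x < k)%N) ->
  exists t, (t < k)%N /\ infinite_set [set x | V x /\ h x = t].
Proof.
move=> Vinf hk; apply: contrapT => nt; apply: Vinf.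
apply: (@sub_finite_set _ _ (\bigcup_(t in `I_k) [set x | V x /\ h x = t])).
  by move=> x Vx; exists (h x) => //; apply: hk.
apply: bigcup_finite => [|t tk]; first exact: finite_II.
by apply: contrapT => it; apply: nt; exists t.
Qed.

Lemma infinite_injection (T : Type) (I : set T) : infinite_set I ->
  exists e : nat -> T, (forall n, I (e n)) /\ injective e.
Proof.
elim/Ppointed: T => T in I *; first by rewrite emptyE => /(_ (finite_set0 _)).
move=> /infiniteP/pcard_leP[e].
exists e; split=> [n|]; first exact: (@funS _ _ _ _ e n).
by move=> a b; apply: (@inj _ _ _ e); rewrite in_setT.
Qed.

(** An infinite color class is independent, so its vertices can be placed at will, and
    they are used to cover [A] outside [Z]. All other vertices follow greedily inside
    [A] and [Z], which is still [U]-large. With [Z] sparse, what is lost does not count. *)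
Lemma hosts_ultra (T : Type) (H : sgraph T) c i k (A Z : set nat)
    (U : set_system nat) :
  locally_finite H -> countable (vertices H) -> colorable H k -> symmetric c ->
  UltraFilter U -> (forall F, finite_set F -> U (~` F)) -> U A -> U Z ->
  (forall v, A v -> U (nbhd_col c i v)) -> hosts H c i (A `\` Z) A.
Proof.
move=> Hlf Hct [h [hk hc]] csym UU Ufree UA UZ AU V VH Vinf.
have [t [_ tinf]] := @infinite_color_class _ _ h k Vinf (fun x Vx => hk x (VH x Vx)).
have [e [eI einj]] := infinite_injection tinf.
pose D := e @` (A `\` Z).
have [|f0 f0e] := @choice _ _ (fun x n => forall m, e m = x -> n = m).
  move=> x; have [[n nx]|nx] := pselect (exists n, e n = x); last first.
    by exists 0%N => m mx; case: nx; exists m.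
  by exists n => m mx; apply: einj; rewrite mx.
have f0E n : f0 (e n) = n by apply: f0e.
have UAZ : U (A `&` Z) by apply: filterI.
pose E := [set x | V x /\ ~ D x].
have [||x Ex|x Dx|x y Ex Ey xy v [Av _]|f [fN finj fA fc]] :=
  @extend_embedding T (edge H) D E f0 c i U _ (@edge_sym _ H) (@edge_irr _ H) csym UU Ufree UAZ.
- by apply: sub_countable Hct; apply: subset_card_le => x [/VH].
- by move=> x Dx [].
- by case: Ex => /VH /Hlf Fx _; apply: sub_finite_set Fx => y [].
- by case: Dx => n [An _] <-; rewrite f0E; apply: AU.
- exact: AU.
have fD n : (A `\` Z) n -> f (e n) = n.
  by move=> AZn; rewrite fN ?f0E // => -[_]; apply; exists n.
have DV x : V x -> D x \/ E x.
  by move=> Vx; have [Dx|nDx] := pselect (D x); [left|right].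
exists f; split; last first.
- by move=> n AZn; exists (e n); [have [] := eI n|apply: fD].
- move=> x /DV[[n AZn <-]|/fA[]//]; by rewrite fD //; case: AZn.
split=> x y /DV Dx /DV Dy.
  case: Dx Dy => [[n AZn <-]|Ex] [[m AZm <-]|Ey].
  - by rewrite !fD // => ->.
  - by rewrite fD // => nf; have [_ Zf] := fA _ Ey; case: AZn; rewrite nf.
  - by rewrite fD // => nf; have [_ Zf] := fA _ Ex; case: AZm; rewrite -nf.
  - exact: finj.
case: Dx Dy => [Dx|Ex] [Dy|Ey] xy.
- case: Dx Dy xy => [n _ <-] [m _ <-] /hc.
  by have [_ ->] := eI n; have [_ ->] := eI m.
- by rewrite csym; apply: fc => //; [left|rewrite edge_sym].
- by apply: fc => //; left.
- by apply: fc => //; right.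
Qed.

(** An infinite color class is mapped bijectively onto [B]; the [p] other classes are
    placed in [M]. *)
Lemma hosts_extendable (T : Type) (H : sgraph T) c i p (B M : set nat) :
  countable (vertices H) -> colorable H p.+1 -> infinite_set B ->
  extendable H c i p B M -> hosts H c i B (B `|` M).
Proof.
move=> Hct [h [hk hc]] Binf Bext V VH Vinf.
have [t [tp tinf]] := @infinite_color_class _ _ h _ Vinf (fun x Vx => hk x (VH x Vx)).
set D := [set x | _] in tinf.
have Dct : countable D by apply: sub_countable Hct; apply: subset_card_le => x [/VH].
have /card_set_bijP[f0 [f0B f0inj f0surj]] : D #= B.
  apply: card_eq_trans (eq_card_nat Dct tinf) _.
  by rewrite card_eq_sym; apply: eq_card_nat.
(* the colors above [t] are shifted down to close the gap *)
pose h' x := if (h x < t)%N then h x else (h x).-1.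
have [||||x Vx nDx|x y Vx nDx Vy nDy xy|f [femb fD fM]] := Bext V D h' f0.
- by [].
- by move=> x [].
- split=> [x y Dx Dy|x y [_ hx] [_ hy] /hc]; first by apply: f0inj; rewrite inE.
  by rewrite hx hy.
- exact: f0B.
- have ht : h x <> t by move=> hx; apply: nDx; split.
  by have := hk x (VH x Vx); rewrite /h'; case: ifP; lia.
- have htx : h x <> t by move=> hx; apply: nDx; split.
  have hty : h y <> t by move=> hx; apply: nDy.
  by have := hc x y xy; rewrite /h'; case: ifP; case: ifP; lia.
exists f; split=> // [x Vx|n Bn].
  have [Dx|nDx] := pselect (D x); last by right; apply: fM.
  by left; rewrite fD //; exact: f0B.
have [x Dx xn] := f0surj n Bn; exists x; first by case: Dx.
by rewrite fD.
Qed.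

(** * Decomposing a coloring into few coverable sets *)

Lemma sub_hosts (T : Type) (H : sgraph T) c i (W W' A : set nat) :
  W' `<=` W -> hosts H c i W A -> hosts H c i W' A.
Proof.
move=> W'W hW V VH Vinf; have [f [femb fA fW]] := hW V VH Vinf.
by exists f; split=> // n /W'W; apply: fW.
Qed.

(** The sets in [G i] have been split off in color [i], and [B] is what remains. Each set
    in [G (~~ i)] is one more part that can be used in color [i] to extend embeddings from
    [B], so that the number of parts is [size (G (~~ i))]. The union of the sparse sets that
    need not be covered is [Z]. The default value [set0] of [nth] makes bounds on the
    indices superfluous in the disjointness conditions. *)
Definition decomposition (T : Type) (H : sgraph T) (c : nat -> nat -> bool)
    (G : bool -> seq (set nat)) (B Z : set nat) : Prop :=
  [/\ sparse Z,
      forall n, (0 < n)%N <-> B n \/ exists i j, nth set0 (G i) j n,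
      forall i j n, nth set0 (G i) j n -> ~ B n,
      forall i i' j j' n, nth set0 (G i) j n -> nth set0 (G i') j' n -> i = i' /\ j = j' &
      (forall i j, (j < size (G i))%N ->
         hosts H c i (nth set0 (G i) j `\` Z) (nth set0 (G i) j)) /\
      forall i, extendable H c i (size (G (~~ i))) B (\bigcup_j nth set0 (G (~~ i)) j)].

Lemma decomposition0 (T : Type) (H : sgraph T) c :
  decomposition H c (fun=> [::]) [set n | (0 < n)%N] set0.
Proof.
split.
- by apply: sparse_finite; apply: finite_set0.
- by move=> n; split=> [n0|[//|[i [j]]]]; [left|rewrite nth_nil].
- by move=> i j n; rewrite nth_nil.
- by move=> i i' j j' n; rewrite nth_nil.
split=> [//|i]; rewrite (_ : \bigcup_j _ = set0); first exact: extendable0.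
by apply/seteqP; split=> // n [j _]; rewrite nth_nil.
Qed.

(** Let [U] be a free ultrafilter on [B] that contains a sparse set. The vertices whose
    [U]-large neighborhood has the majority color [i] form the new set of color [i]. All
    others have [U]-large neighborhoods of the opposite color, so the new set is a further
    part for [B'] in that color. *)
Lemma decompositionS (T : Type) (H : sgraph T) c k G B Z :
  locally_finite H -> countable (vertices H) -> colorable H k -> symmetric c ->
  decomposition H c G B Z -> infinite_set B ->
  exists i A B' Z',
    decomposition H c (fun j => if j == i then A :: G j else G j) B' Z'.
Proof.
move=> Hlf Hct Hcol csym [Zs BG GB Gd [Gh Ge]] Binf.
have [Z1 [Z1B Z1inf Z1s]] := ex_sparse Binf.
have [U [UU UZ1 Ufree]] := ex_free_ultrafilter Z1inf.
have UB : U B by apply: filterS UZ1.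
pose P b := [set v | B v /\ U (nbhd_col c b v)].
have [i UP] : exists i, U (P i) by apply: majority_color.
have PU v : (B `\` P i) v -> U (nbhd_col c (~~ i) v).
  by move=> [Bv nP]; apply: ultra_nbhd_col => // Uv; apply: nP.
have UZ : U (Z `|` Z1) by apply: filterS UZ1 => v; right.
exists i, (P i), (B `\` P i), (Z `|` Z1); split.
- exact: sparseU.
- move=> n; rewrite BG; split=> [[Bn|[i' [j ijn]]]|[[Bn _]|[i' [j]]]].
  + have [Pn|nPn] := pselect (P i n); last by left.
    by right; exists i, 0%N; rewrite eqxx.
  + right; exists i'; case: eqP => _; last by exists j.
    by exists j.+1.
  + by left.
  + case: eqP => _; last by right; exists i', j.
    by case: j => [[? _]|j ijn]; [left|right; exists i', j].
- move=> i' j n; case: eqP => [->|_]; last by move=> /GB nB [].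
  by case: j => [Pn []//|j /GB nB []].
- have PG i' j n : P i n -> ~ nth set0 (G i') j n by move=> [Bn _] /GB.
  move=> i1 i2 j1 j2 n; case: eqP => [->|ne1]; case: eqP => [->|ne2].
  + case: j1 => [|j1] /=; case: j2 => [|j2] //=.
    * by move=> Pn /(PG _ _ _ Pn).
    * by move=> nG Pn; case: (PG _ _ _ Pn nG).
    * by move=> h1 h2; have [_ ->] := Gd _ _ _ _ _ h1 h2.
  + case: j1 => [|j1] /=; first by move=> Pn /(PG _ _ _ Pn).
    by move=> h1 h2; have [/esym] := Gd _ _ _ _ _ h1 h2.
  + case: j2 => [|j2] /=; first by move=> nG Pn; case: (PG _ _ _ Pn nG).
    by move=> h1 h2; have [] := Gd _ _ _ _ _ h1 h2.
  + exact: Gd.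
split=> [i' j|i'].
  have Gh' l : (l < size (G i'))%N ->
      hosts H c i' (nth set0 (G i') l `\` (Z `|` Z1)) (nth set0 (G i') l).
    by move=> /Gh; apply: sub_hosts => n [Gn nZ]; split=> // Zn; apply: nZ; left.
  case: eqP Gh' => [->|_] Gh'; last exact: Gh'.
  case: j => [|j] /=; last exact: Gh'.
  by move=> _; apply: (@hosts_ultra _ _ _ _ k _ _ U) => // v [].
have [->|/eqP ne] := eqVneq i' i.
  rewrite ifN; last by case: (i).
  by apply: sub_extendable (Ge i) => n [].
have -> : i' = ~~ i by case: (i') (i) ne => -[].
rewrite negbK eqxx /=.
rewrite (_ : \bigcup_j _ = P i `|` \bigcup_j nth set0 (G i) j); last first.
  apply/seteqP; split=> n.
    by move=> [[|j] _ /=]; [left|right; exists j].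
  by move=> [Pn|[j _ Gn]]; [exists 0%N|exists j.+1].
have := Ge (~~ i); rewrite negbK; apply: extendableS => //.
  by move=> n [].
by move=> n Pn [].
Qed.

(** Every step lengthens one of the two lists by one set, so that one of them reaches
    the length [K] while the other one is still shorter, unless [B] becomes finite. *)
Lemma ex_decomposition (T : Type) (H : sgraph T) c k K :
  locally_finite H -> countable (vertices H) -> colorable H k -> symmetric c ->
  (0 < K)%N -> exists G B Z,
  [/\ decomposition H c G B Z, forall i, (size (G i) <= K)%N &
      finite_set B \/ exists i, size (G i) = K /\ (size (G (~~ i)) < K)%N].
Proof.
move=> Hlf Hct Hcol csym K0.
(* [d] bounds the number of steps that are left *)
suff: forall d G B Z, decomposition H c G B Z -> (forall i, (size (G i) < K)%N) ->
    (K + K <= d + size (G true) + size (G false))%N -> exists G B Z,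
  [/\ decomposition H c G B Z, forall i, (size (G i) <= K)%N &
      finite_set B \/ exists i, size (G i) = K /\ (size (G (~~ i)) < K)%N].
  move=> main; have D0 := decomposition0 H c.
  by apply: (main (K + K)%N _ _ _ D0) => //=; lia.
elim=> [|d IH] G B Z dec GK dK.
  by have := GK true; have := GK false; lia.
have [Bfin|Binf] := pselect (finite_set B).
  by exists G, B, Z; split=> // [i|]; [apply: ltnW|left].
have [i [A [B' [Z' dec']]]] := decompositionS Hlf Hct Hcol csym dec Binf.
set G' := (fun j => _) in dec'.
have G'i : size (G' i) = (size (G i)).+1 by rewrite /G' eqxx.
have G'ni : size (G' (~~ i)) = size (G (~~ i)) by rewrite /G' ifN //; case: (i).
have [eK|nK] := eqVneq (size (G i)).+1 K.
  exists G', B', Z'; split=> //.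
    move=> j; have [->|/eqP ji] := eqVneq j i; first by rewrite G'i eK.
    by have -> : j = ~~ i; [case: (j) (i) ji => -[]|rewrite G'ni ltnW].
  by right; exists i; rewrite G'i G'ni.
apply: (IH _ _ _ dec').
  move=> j; have [->|/eqP ji] := eqVneq j i; first by rewrite G'i; have := GK i; lia.
  by have -> : j = ~~ i; [case: (j) (i) ji => -[]|rewrite G'ni].
by move: dK; case: (i) G'i G'ni => /= -> ->; lia.
Qed.

(** When there are [K] sets of color [r], the remaining set [B] can be covered in the
    opposite color, and it is added to the list of that color, which has room for it.
    A finite [B] can be neglected. *)
Lemma ex_host_family (T : Type) (H : sgraph T) c K :
  locally_finite H -> countable (vertices H) -> colorable H K.+1 -> symmetric c ->
  (0 < K)%N -> exists (m : bool -> nat) (W A : bool -> nat -> set nat) (Z : set nat),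
  [/\ sparse Z, forall i, (m i <= K)%N,
      forall n, (0 < n)%N -> Z n \/ exists i j, (j < m i)%N /\ W i j n &
      forall i, [/\ forall j, (j < m i)%N -> hosts H c i (W i j) (A i j),
        forall j n, W i j n -> A i j n,
        forall j n, A i j n -> (0 < n)%N &
        forall j j' n, A i j n -> A i j' n -> j = j']].
Proof.
move=> Hlf Hct Hcol csym K0.
have [G [B [Z [[Zs BG GB Gd [Gh Ge]] GK BK]]]] := ex_decomposition Hlf Hct Hcol csym K0.
have G0 i j n : nth set0 (G i) j n -> (0 < n)%N.
  by move=> Gn; apply/BG; right; exists i, j.
have Gsize i j n : nth set0 (G i) j n -> (j < size (G i))%N.
  by rewrite ltnNge => Gn; apply/negP => /(nth_default set0) Gj; rewrite Gj in Gn.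
have [Bfin|Binf] := pselect (finite_set B).
  exists (size \o G), (fun i j => nth set0 (G i) j `\` Z), (fun i => nth set0 (G i)), (Z `|` B).
  split=> //.
  - by apply: sparseU => //; apply: sparse_finite.
  - move=> n /BG[Bn|[i [j Gn]]]; first by left; right.
    have [Zn|nZn] := pselect (Z n); first by left; left.
    by right; exists i, j; split; [exact: Gsize Gn|].
  move=> i; split=> [j /Gh//|j n []//|j n /G0//|j j' n h1 h2].
  by have [_] := Gd _ _ _ _ _ h1 h2.
case: BK => // -[r [Gr Gnr]].
pose M := \bigcup_j nth set0 (G r) j.
(* [B] with its room [M] is put in front of the list of the color opposite to [r] *)
pose A i := if i == r then nth set0 (G i) else nth set0 ((B `|` M) :: G i).
pose W i := if i == r then fun j => nth set0 (G i) j `\` Z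
  else fun j => if j is j'.+1 then nth set0 (G i) j' `\` Z else B.
exists (fun i => if i == r then size (G i) else (size (G i)).+1), W, A, Z; split=> //.
- by move=> i; case: eqP => // /eqP ir; have -> : i = ~~ r; [case: (i) (r) ir => -[]|].
- move=> n /BG[Bn|[i [j Gn]]].
    right; exists (~~ r), 0%N; rewrite /W.
    by have -> : (~~ r == r) = false by case: (r).
  have [Zn|nZn] := pselect (Z n); first by left.
  right; exists i; rewrite /W; case: eqP => [_|_]; first by exists j; split; [exact: Gsize Gn|].
  by exists j.+1; split; [rewrite ltnS; exact: Gsize Gn|].
have AB i j n : nth set0 (G i) j n -> i <> r -> ~ (B `|` M) n.
  by move=> Gn ir [/(GB _ _ _ Gn)//|[j' _ Gn']]; case: (Gd _ _ _ _ _ Gn Gn').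
move=> i; rewrite /W /A; case: eqP => [_|ir].
  split=> [j /Gh//|j n []//|j n /G0//|j j' n h1 h2].
  by have [_] := Gd _ _ _ _ _ h1 h2.
split=> [[|j]|[|j] n|[|j] n|[|j] [|j'] n] //=.
- move=> _; apply: (@hosts_extendable _ _ _ _ K) => //.
  by have := Ge i; have -> : ~~ i = r; [case: (i) (r) ir => -[]|rewrite Gr].
- by rewrite ltnS => /Gh.
- by move=> Bn; left.
- by case.
- by move=> [Bn|[j _ /G0//]]; apply/BG; left.
- exact: G0.
- by move=> BMn /AB/(_ ir).
- by move=> /AB/(_ ir).
- by move=> h1 h2; have [_ ->] := Gd _ _ _ _ _ h1 h2.
Qed.

(** * Assembling a copy of the graph *)

(** The map [g] distributes the components of [H] over disjoint regions [A a], so the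
    embeddings of the parts do not interfere. *)
Lemma glue_embeddings (T I : Type) (H : sgraph T) c i (P : set I) (g : T -> I)
    (W A : I -> set nat) :
  (forall x y, edge H x y -> g x = g y) ->
  (forall x, vertices H x -> P (g x)) ->
  (forall a b n, P a -> P b -> A a n -> A b n -> a = b) ->
  (forall a, P a -> exists f : T -> nat,
     let V := [set x | vertices H x /\ g x = a] in
     [/\ mono_embedding H c i V f, forall x, V x -> A a (f x) &
       forall n, W a n -> exists2 x, V x & f x = n]) ->
  exists f : T -> nat, [/\ mono_embedding H c i (vertices H) f,
    forall x, vertices H x -> A (g x) (f x) &
    forall a n, P a -> W a n -> exists2 x, vertices H x & f x = n].
Proof.
move=> ge gP Adisj Hf.
have [|F FP] := @choice _ _ (fun a (f : T -> nat) => P a ->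
     let V := [set x | vertices H x /\ g x = a] in
     [/\ mono_embedding H c i V f, forall x, V x -> A a (f x) &
       forall n, W a n -> exists2 x, V x & f x = n]).
  move=> a; have [Pa|nPa] := pselect (P a); last by exists (fun=> 0%N).
  by have [f fP] := Hf a Pa; exists f.
exists (fun x => F (g x) x); split.
- split=> x y Hx Hy.
    move=> Fxy; have [_ xA _] := FP _ (gP x Hx); have [_ yA _] := FP _ (gP y Hy).
    have gxy : g x = g y.
      apply: Adisj (gP x Hx) (gP y Hy) (xA x _) _; first by split.
      by rewrite Fxy; apply: yA.
    have [[Finj _] _ _] := FP _ (gP x Hx).
    by apply: Finj; rewrite // Fxy gxy.
  move=> xy; have [[_ Fc] _ _] := FP _ (gP x Hx).
  by rewrite -(ge _ _ xy); apply: Fc => //; split=> //; rewrite (ge _ _ xy).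
- by move=> x Hx; have [_ xA _] := FP _ (gP x Hx); apply: xA.
by move=> a n Pa Wn; have [_ _ /(_ n Wn)[x [Hx ga] Fx]] := FP a Pa; exists x; rewrite ?ga.
Qed.

Lemma copy_of_embedding (T : Type) (H : sgraph T) c i (f : T -> nat) :
  vertices H !=set0 -> mono_embedding H c i (vertices H) f ->
  (forall x, vertices H x -> (0 < f x)%N) ->
  exists H' : sgraph nat, [/\ subgraph H' KN, monochromatic c H', isomorphic H' H &
    vertices H' = f @` vertices H].
Proof.
move=> [x0 Hx0] [finj fc] f0.
pose e (a b : nat) := `[< exists x y, [/\ edge H x y, f x = a & f y = b] >].
have esym' : symmetric e.
  by move=> a b; apply/asboolP/asboolP => -[x [y [xy fx fy]]]; exists y, x; rewrite edge_sym.
have eV a b : e a b -> (f @` vertices H) a.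
  by move=> /asboolP[x [y [xy <- _]]]; exists x => //; exact: edge_vertices xy.
have eirr : irreflexive e.
  move=> a; apply/asboolP => -[x [y [xy <- fxy]]].
  have xE : x = y by apply: finj => //; [exact: edge_vertices xy|exact: edge_verticesr xy].
  by rewrite xE edge_irr in xy.
exists (SGraph esym' eirr eV); split=> //=.
- split=> [a [x Hx <-]|a b /= eab]; first exact: f0.
  have [x Hx fx] := eV _ _ eab; have [y Hy fy] : (f @` vertices H) b.
    by apply: eV; rewrite esym'; exact: eab.
  apply/and3P; split; rewrite -?fx -?fy ?f0 //.
  by apply: contraTneq eab => fxy; rewrite -fx -fy fxy eirr.
- exists i => a b /asboolP[x [y [xy <- <-]]].
  by apply: fc => //; [exact: edge_vertices xy|exact: edge_verticesr xy].
have [|g gP] := @choice _ _ (fun n x => (f @` vertices H) n -> vertices H x /\ f x = n).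
  move=> n; have [[x Hx fx]|nx] := pselect ((f @` vertices H) n); last by exists x0.
  by exists x.
have gf x : vertices H x -> g (f x) = x.
  by move=> Hx; have [|] := gP (f x); [exists x|move=> ? ?; apply: finj].
exists g; split; first split=> /=.
- by move=> n /gP[].
- move=> a b; rewrite !inE => /gP[_ ga] /gP[_ gb] gab; by rewrite -ga -gb gab.
- by move=> x Hx; exists (f x); [exists x|exact: gf].
move=> _ _ [x Hx <-] [y Hy <-]; rewrite !gf //.
apply/asboolP/idP => [[x' [y' [xy fx fy]]]|xy]; last by exists x, y.
suff [-> ->] : x = x' /\ y = y' by [].
by split; apply: finj => //; [exact: edge_vertices xy|exact: edge_verticesr xy].
Qed.

(** * Lower bound for infinitely many components *)

(** A bijection between the components and the pairs of natural numbers assigns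
    infinitely many components to every clique. In a clique, any bijection is a
    monochromatic embedding. *)
Lemma ramsey_density_ge_infinite (R : realType) (T : Type) (H : sgraph T) :
  countably_infinite H -> infinite_set (components H) ->
  1 / 2 <= ramsey_upper_density R H.
Proof.
move=> Hinf Cinf; apply: ramsey_density_ge => c csym.
pose clique i (C : set nat) := forall x y, C x -> C y -> x != y -> c x y = i.
pose D := [set C : set nat |
  [/\ C `<=` [set n | (0 < n)%N], infinite_set C & exists i, clique i C]].
have [E [ED Etriv Emax]] := ex_maximal_disjoint_subcollection id D.
pose S i := \bigcup_(C in [set C | E C /\ clique i C]) C.
pose Z := [set n | (0 < n)%N] `\` \bigcup_(C in E) C.
have Zfin : finite_set Z.
  apply: contrapT => Zinf; have [C [i [CZ CN Ci]]] := infinite_clique csym Zinf.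
  have [x Cx] := infinite_setN0 CN.
  have EC C' : E C' -> C `&` C' !=set0 -> False.
    by move=> EC' [y [/CZ[_ nE] C'y]]; apply: nE; exists C'.
  apply: (Emax (E `|` [set C])).
  - split; first by move=> C' ?; left.
    by move=> /(_ C (or_intror erefl)) /EC; apply; exists x.
  - move=> C' [/ED//|->]; split=> //; last by exists i.
    by move=> y /CZ[].
  - move=> A B [EA|->] [EB|->] //.
    + exact: Etriv.
    + by rewrite setIC => /(EC _ EA).
    + by move=> /(EC _ EB).
have cov k : (0 < k)%N -> Z k \/ exists i, S i k.
  move=> k0; have [[C EC Ck]|nk] := pselect ((\bigcup_(C in E) C) k); last by left.
  by right; have [_ _ [i Ci]] := ED _ EC; exists i, C.
have [i Si] := majority_density cov.
have [C0 [EC0 C0i]] : exists C, E C /\ clique i C.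
  have [N NP] := sparse_lt (sparse_finite Zfin); have [n [Nn nS]] := Si N.
  apply: contrapT => nC; have := NP n Nn.
  suff S0 : count_upto (S i) n = 0%N by move: nS; rewrite S0; lia.
  rewrite /count_upto big1 // => k _; rewrite asboolF // => -[C [EC Ci] _].
  by apply: nC; exists C.
have Vct := countably_infinite_countable Hinf.
have Hct : countable (components H).
  apply: sub_countable Vct; apply: card_le_trans (card_image_le (component H) (vertices H)).
  by apply: subset_card_le => C [x Hx ->]; exists x.
have /card_set_bijP[phi [phiT phi_inj phi_surj]] : components H #= [set: nat * nat].
  apply: card_eq_trans (eq_card_nat Hct Cinf) _; rewrite card_eq_sym; exact: card_nat2.
pose F := [set C | E C /\ clique i C].
(* The integer [n] stands for the clique that contains it, so that cliques need not be
   enumerated; [C0] takes care of the integers that are in no clique of color [i]. *)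
pose tau n := xget C0 [set C | F C /\ C n].
have tauF n : F (tau n) by rewrite /tau; case: xgetP => // C _ [].
have tauE C n : F C -> C n -> tau n = C.
  move=> FC Cn; rewrite /tau; case: xgetP => [C' -> [[EC' _] C'n]|/(_ C)]; last by case.
  by apply: Etriv => //; [exact: FC.1|exists n].
pose g x := tau (phi (component H x)).1.
have [||A B n FA FB An Bn|C FC|f [femb fA fW]] :=
    @glue_embeddings T (set nat) H c i F g id id.
- by move=> x y xy; rewrite /g (eq_component (connected_in_edge xy)).
- by move=> x _; apply: tauF.
- by apply: Etriv; [exact: FA.1|exact: FB.1|exists n].
- have [CN Cinf' _] := ED _ FC.1; set V := [set x | _].
  have Vinf : infinite_set V.
    have [n Cn] := infinite_setN0 Cinf'; move=> Vfin; apply: infinite_nat.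
    apply: sub_finite_set (finite_image (fun x => (phi (component H x)).2) Vfin).
    move=> k _; have [C' [x Hx ->]] := phi_surj (n, k) I.
    rewrite -/(component H x) => phix.
    exists x; last by rewrite /= phix.
    by split=> //; rewrite /g phix; apply: tauE.
  have Vct' : countable V by apply: sub_countable Vct; apply: subset_card_le => x [].
  have /card_set_bijP[f [fC finj fsurj]] : V #= C.
    apply: card_eq_trans (eq_card_nat Vct' Vinf) _; rewrite card_eq_sym.
    exact: eq_card_nat.
  exists f; split=> //.
  have {}finj x y : V x -> V y -> f x = f y -> x = y by move=> Vx Vy; apply: finj; rewrite inE.
  split=> // x y Vx Vy xy; apply: FC.2; [exact: fC|exact: fC|].
  by apply: contraTneq xy => /(finj _ _ Vx Vy) ->; rewrite edge_irr.
have HN0 : vertices H !=set0.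
  by have [C [x Hx _]] := infinite_setN0 Cinf; exists x.
have [|H' [H1 H2 H3 HV]] := copy_of_embedding HN0 femb.
  move=> x Hx; have [EC _] := tauF (phi (component H x)).1.
  by have [CN _ _] := ED _ EC; apply: CN; exact: fA.
exists H'; split=> //.
have -> : 1 / 2 = 1%:R / 2%:R :> R by [].
apply: (@upper_density_ge_count _ _ Z) => //; first exact: sparse_finite.
move=> N; have [n [Nn nS]] := Si N; exists n; split=> //.
have : (count_upto (S i) n <= count_upto (vertices H') n)%N.
  apply: subset_count_upto => k _ [C FC Ck]; rewrite HV.
  by have [x Hx fx] := fW C k FC Ck; exists x.
lia.
Qed.

(** * Lower bound for finitely many components *)

(** If color [i] has [m i] sets and these make up half of the integers, the best
    [r = min b (m i)] of them have density at least [r / (2 * m i)], and the [b] infinite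
    components are enough to give each of them one. As [m i <= K], this is at least the
    bound. *)
Lemma ramsey_density_ge_finite (R : realType) (T : Type) (H : sgraph T) (K b : nat) :
  locally_finite H -> countably_infinite H -> colorable H K.+1 -> (0 < K)%N ->
  infinite_components H #= `I_b -> (0 < b)%N ->
  Num.min (b%:R / (2 * K%:R)) (1 / 2) <= ramsey_upper_density R H.
Proof.
move=> Hlf Hinf Hcol K0 Hb b0; apply: ramsey_density_ge => c csym.
have Vct := countably_infinite_countable Hinf.
have [m [W [A [Z [Zs mK cov fam]]]]] := ex_host_family Hlf Vct Hcol csym K0.
pose S i := [set k | exists j, (j < m i)%N /\ W i j k].
have [i Si] : exists i, forall N, exists n, (N <= n)%N /\
    (n <= 2 * count_upto (S i) n + count_upto Z n)%N.
  by apply: majority_density => k /cov[|[i [j jW]]]; [left|right; exists i, j].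
have [hostW WA A0 Ad] := fam i.
have mi0 : (0 < m i)%N.
  have [N NP] := sparse_lt Zs; have [n [Nn nS]] := Si N.
  rewrite lt0n; apply: contraTneq nS => mi; rewrite -ltnNge.
  have := NP n Nn; suff -> : count_upto (S i) n = 0%N by [].
  by apply/eqP; rewrite -leqn0 (leq_trans (count_upto_bigcup _ _ _)) // mi big_ord0.
pose r := minn b (m i).
have rm : (r <= m i)%N := geq_minr _ _.
have r0 : (0 < r)%N by rewrite /r leq_min b0.
have [Q [Qr QP]] : exists Q : {set 'I_(m i)}, #|Q| = r /\ forall N, exists n, (N <= n)%N /\
    (r * n <= 2 * m i * (\sum_(j in Q) count_upto (W i j) n + count_upto Z n))%N.
  suff [Q QP] : exists Q : {set 'I_(m i)}, forall N, exists n, (N <= n)%N /\ (#|Q| = r /\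
      (r * n <= 2 * m i * (\sum_(j in Q) count_upto (W i j) n + count_upto Z n))%N).
    exists Q; split=> [|N]; first by have [n [_ []]] := QP 0%N.
    by have [n [Nn [_ nQ]]] := QP N; exists n.
  apply: frequently_pigeonhole => N; have [n [Nn nS]] := Si N; exists n; split=> //.
  have [Q [Qr Qa]] := top_average (fun j => count_upto (W i j) n) rm.
  exists Q; split=> //; have := count_upto_bigcup (m i) (W i) n.
  rewrite -/(S i); move: nS Qa.
  set s := (\sum_j _)%N; set t := (\sum_(j in _) _)%N; set z := count_upto Z n.
  set u := count_upto _ n => nS Qa us.
  have h1 : (r * n <= r * (2 * s + z))%N by rewrite leq_mul2l; apply/orP; right; lia.
  have h2 : (r * z <= m i * z)%N by rewrite leq_mul2r rm orbT.
  by nia.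
have [j0 j0Q] : exists j, j \in Q by apply/set0Pn; rewrite -card_gt0 Qr.
have /card_set_bijP[phi [phiI phi_inj phi_surj]] := Hb.
(* The [r] first infinite components go to the [r] sets chosen; for all other components
   it does not matter which of these sets they go to. *)
pose g x := nth j0 (enum Q) (phi (component H x)).
have gQ x : g x \in Q.
  rewrite /g; have [lt|ge] := ltnP (phi (component H x)) (size (enum Q)).
    by rewrite -mem_enum mem_nth.
  by rewrite nth_default.
have [||a a' n _ _ An An'|a aQ|f [femb fA fW]] :=
    @glue_embeddings T 'I_(m i) H c i [set` Q] g (fun j => W i j) (fun j => A i j).
- by move=> x y xy; rewrite /g (eq_component (connected_in_edge xy)).
- by move=> x _; apply: gQ.
- by apply: val_inj; apply: Ad An An'.
- apply: hostW => //; first by move=> x [].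
  have ib : (index a (enum Q) < b)%N.
    by apply: leq_trans (geq_minl b (m i)); rewrite -/r -Qr cardE index_mem mem_enum.
  have [C [CH Cinf] phiC] := phi_surj _ ib.
  apply: sub_infinite_set Cinf => x Cx; have [Hx xC] := component_mem CH Cx.
  by split=> //; rewrite /g xC phiC nth_index // mem_enum.
have HN0 : vertices H !=set0.
  apply: infinite_setN0 => Vfin; apply: infinite_nat.
  by move: Vfin; rewrite (eq_finite_set Hinf).
have [|H' [H1 H2 H3 HV]] := copy_of_embedding HN0 femb.
  by move=> x Hx; apply: A0; exact: fA.
exists H'; split=> //.
have bound : Num.min (b%:R / (2 * K%:R)) (1 / 2) <= r%:R / (2 * m i)%:R :> R.
  rewrite /r; case: (leqP b (m i)) => bm; rewrite ge_min; apply/orP; [left|right].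
    rewrite natrM ler_wpM2l // lef_pV2 ?posrE ?mulr_gt0 ?ltr0n // ler_pM2l //.
    by rewrite ler_nat.
  by rewrite natrM invfM mulrCA divff ?mulr1 ?mul1r // pnatr_eq0 -lt0n.
apply: (le_trans bound); apply: (@upper_density_ge_count _ _ Z) => //.
  by rewrite muln_gt0.
move=> N; have [n [Nn nQ]] := QP N; exists n; split=> //.
apply: leq_trans nQ _; rewrite leq_mul2l leq_add2r; apply/orP; right.
apply: sum_count_upto => [j j' k Wj Wj'|j k jQ k0 Wj].
  by apply: (Ad _ _ k); apply: WA.
by rewrite HV; have [x Hx fx] := fW j k jQ Wj; exists x.
Qed.

(** * Upper bound *)

Definition residue_coloring (k x y : nat) : bool := (x %% k == y %% k)%N.

Lemma count_residue (k r n : nat) : (0 < k)%N ->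
  (k * count_upto [set x | (x %% k)%N = r] n <= n + k)%N.
Proof.
move=> k0; have [rk|kr] := ltnP r k; last first.
  rewrite /count_upto big1 ?muln0 // => x _; rewrite asboolF // => xr.
  by have := ltn_pmod x k0; rewrite xr ltnNge kr.
(* [(n - r) mod k] counts the steps since the last element of the class; adding it makes
   the bound inductive. *)
suff : (k * count_upto [set x | (x %% k)%N = r] n + (n + (k - r)) %% k <= n + k)%N by lia.
elim: n => [|n IH].
  by rewrite count_upto0 muln0 !add0n ltnW // ltn_mod.
rewrite count_uptoS; case: asboolP => [nr|/eqP nr] /=.
  have e0 : (n.+1 + (k - r) = (n.+1 %/ k).+1 * k)%N.
    by rewrite {1}(divn_eq n.+1 k) nr mulSn; lia.
  have e1 : (n + (k - r) = (n.+1 %/ k) * k + k.-1)%N by move: e0; rewrite mulSn; lia.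
  have : ((n + (k - r)) %% k)%N = k.-1 by rewrite e1 modnMDl modn_small //; lia.
  by rewrite e0 modnMl; lia.
have : ((n.+1 + (k - r)) %% k <= ((n + (k - r)) %% k).+1)%N.
  by rewrite addSn -addn1 -modnDml addn1; apply: leq_mod.
lia.
Qed.

Lemma isomorphic_section (T : Type) (H : sgraph T) (H' : sgraph nat) (f : nat -> T) :
  set_bij (vertices H') (vertices H) f ->
  exists g : T -> nat, forall x, vertices H x -> vertices H' (g x) /\ f (g x) = x.
Proof.
move=> [_ _ fsurj].
have [|g gP] := @choice _ _ (fun x n => vertices H x -> vertices H' n /\ f n = x).
  move=> x; have [Hx|] := pselect (vertices H x); last by exists 0%N.
  by have [n Hn fn] := fsurj x Hx; exists n.
by exists g.
Qed.

(** Between residue classes the coloring is [k]-partite, which excludes copies of [H].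
    Within them, a connected set cannot leave its class, so [b] classes contain all of the
    copy except its finite components. *)
Lemma ramsey_density_le_finite (R : realType) (T : Type) (H : sgraph T) (k b : nat) :
  (0 < k)%N -> ~ colorable H k -> finite_set (components H) ->
  infinite_components H #= `I_b ->
  ramsey_upper_density R H <= b%:R / k%:R.
Proof.
move=> k0 Hncol Cfin Hb.
apply: (@ramsey_density_le _ _ _ _ (residue_coloring k)).
- by rewrite divr_ge0.
- by move=> x y; rewrite /residue_coloring eq_sym.
move=> H' H'KN [i mono] [f [fbij fe]].
have [g gP] := isomorphic_section fbij.
have ge x y : edge H x y -> edge H' (g x) (g y).
  move=> xy; have [Hx fx] := gP x (edge_vertices xy).
  by have [Hy fy] := gP y (edge_verticesr xy); rewrite fe // fx fy.
case: i mono => mono; last first.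
  case: Hncol; exists (fun x => g x %% k)%N; split=> [x _|x y /ge/mono/eqP//].
  by rewrite ltn_mod.
have res x y : connected_in H x y -> (g x %% k = g y %% k)%N.
  move=> [p [xp <-]]; elim: p x xp => //= z p IH x /andP[xz zp].
  by rewrite -(IH z zp); apply/eqP; apply: mono; apply: ge.
(* [F] consists of the vertices of the copy in finite components *)
have gf a : vertices H' a -> g (f a) = a.
  have [fH finj _] := fbij; move=> Ha; have Hfa : vertices H (f a) by apply: fH.
  by have [Hg fg] := gP _ Hfa; apply: finj; rewrite ?inE.
have fH a : vertices H' a -> vertices H (f a) by case: fbij => fH _ _ /fH.
pose F := g @` (\bigcup_(C in [set C | components H C /\ finite_set C]) C).
have [M MP] : exists M, forall n, (count_upto F n <= M)%N.
  apply: count_upto_finite; apply: finite_image; apply: bigcup_finite => [|C []//].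
  by apply: sub_finite_set Cfin => C [].
have /card_set_bijP[phi [phiI _ phi_surj]] : `I_b #= infinite_components H.
  by rewrite card_eq_sym.
have [|q qP] := @choice _ _ (fun j q => (j < b)%N -> forall x, phi j x -> (g x %% k)%N = q).
  move=> j; have [jb|] := pselect (j < b)%N; last by exists 0%N.
  have [Cj Cjinf] := phiI j jb; have [x Cx] := infinite_setN0 Cjinf.
  exists (g x %% k)%N => _ y Cy; apply: res; rewrite -[connected_in _ _ _]/(component H y x).
  by have [_ ->] := component_mem Cj Cy.
pose Rj j := [set a : nat | (a %% k)%N = q j].
apply: (@upper_density_le_count _ _ _ _ (k * M + b * k)) => // n.
have cov : (count_upto (vertices H') n <=
    count_upto F n + \sum_(j < b) count_upto (Rj j) n)%N.
  apply: leq_trans (leq_add (leqnn _) (count_upto_bigcup b Rj n)).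
  apply: leq_trans (count_uptoU _ _ _); apply: subset_count_upto => a _ Ha.
  have [Cf|Ci] := pselect (finite_set (component H (f a))).
    left; exists (f a); last exact: gf.
    exists (component H (f a)); last exact: connected_in_refl.
    by split=> //; exact: componentP (fH _ Ha).
  have [j jb jC] := phi_surj (component H (f a)) (conj (componentP (fH _ Ha)) Ci).
  right; exists j; split=> //; rewrite /Rj /= -(qP j jb (f a)) ?gf // jC.
  exact: connected_in_refl.
have sumR : (k * (\sum_(j < b) count_upto (Rj j) n) <= b * (n + k))%N.
  rewrite big_distrr /= -[b in leqRHS]card_ord -sum_nat_const.
  by apply: leq_sum => j _; apply: count_residue.
have := MP n; have := leq_mul (leqnn k) cov; rewrite mulnDr.
move: (\sum_(j < b) _)%N sumR => t; nia.
Qed.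

Unset Implicit Arguments.

Theorem theorem1 (R : realType) (T : Type) (H : sgraph T)
    (Hlf : locally_finite H) (Hinf : countably_infinite H) :
  (infinite_set (components H) -> 1 / 2 <= ramsey_upper_density R H) /\
  (finite_set (components H) ->
    (infinite_chromatic_number H -> ramsey_upper_density R H = 0) /\
    (forall chi b : nat, chromatic_number H chi ->
      infinite_components H #= `I_b ->
      Num.min (b%:R / (2 * (chi%:R - 1))) (1 / 2) <= ramsey_upper_density R H
        <= Num.min (b%:R / (chi%:R - 1)) 1)).
Proof.
split; first exact: ramsey_density_ge_infinite.
move=> Cfin; have [C CH Cinf] := finite_component_graph Hinf Cfin.
split=> [Hchi|chi b [Hcol Hmin] Hb].
  have [b Hb] : finite_set (infinite_components H) by apply: sub_finite_set Cfin => D [].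
  apply: le_anti; apply/andP; split; last exact: ramsey_density_ge0.
  apply/ler_addgt0Pr => e e0; rewrite add0r.
  apply: (@le_trans _ _ (b%:R / (Num.truncn (b%:R / e)).+1%:R)).
    by apply: ramsey_density_le_finite Hb.
  rewrite ler_pdivrMr ?ltr0n // mulrC -ler_pdivrMr //; apply: ltW; exact: truncnS_gt.
have chi1 := colorable_gt1 CH Cinf Hcol.
case: chi chi1 Hcol Hmin => [|K] //; rewrite ltnS => K0 Hcol Hmin.
have -> : K.+1%:R - 1 = K%:R :> R by rewrite -natr1 addrK.
have b0 : (0 < b)%N.
  rewrite lt0n; apply/eqP => b0; move: Hb; rewrite b0 II0 card_eq0 => /eqP Hb.
  by have : infinite_components H C by []; rewrite Hb.
apply/andP; split; first exact: ramsey_density_ge_finite.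
rewrite le_min ramsey_density_le1 andbT.
apply: ramsey_density_le_finite Hb => // /Hmin; by rewrite ltnn.
Qed.
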